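(* Let $n$ be a positive integer, $R=\mathbb{Z}[\frac1{3n}]$ and $V=R[x,y]/(x^n,y^3-xy)$, with $R$-basis $\{x^iy^j: 0\le i\le n-1,\ 0\le j\le2\}$. Let $\mu_V\colon V\otimes V\to V$ be the multiplication, $\eta_V\colon R\to V$, $r\mapsto r$, the unit, $\epsilon_V\colon V\to R$ the $R$-linear map with $\epsilon_V(x^{n-1}y^2)=3n$ and zero on all other basis vectors, let $$\Delta_V(v)=-\frac1{3n}\sum_{\substack{i+j=n\\ i,j>0}}(v\cdot x^i)\otimes x^j+\frac1{3n}\sum_{i+j=n-1}\Big((v\cdot x^iy^2)\otimes x^j+(v\cdot x^iy)\otimes x^jy+(v\cdot x^i)\otimes x^jy^2\Big)$$ for $v\in V$ (sums over nonnegative integers $i,j$), and let $$m_V(v)=\begin{cases}v\cdot x^{(n-2)/2}y^2&n\text{ even},\\ v\cdot x^{(n-1)/2}y&n\text{ odd}.\end{cases}$$ Then $(V,\mu_V,\eta_V,\Delta_V,\epsilon_V,m_V)$ is a Möbius Frobenius algebra in $R\mathbf{Mod}$.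
   Context: $R\mathbf{Mod}$ is the symmetric monoidal category of finite-rank free $R$-modules with $\otimes=\otimes_R$. A Möbius Frobenius algebra in a braided monoidal category is a 6-tuple $(A,\mu_A,\eta_A,\Delta_A,\epsilon_A,m_A)$ where $(A,\mu_A,\eta_A,\Delta_A,\epsilon_A)$ (multiplication, unit, comultiplication, counit) is a commutative Frobenius algebra and $m_A\colon A\to A$ is a morphism with $\mu_A\circ(m_A\otimes\mathrm{id}_A)=m_A\circ\mu_A=\mu_A\circ(\mathrm{id}_A\otimes m_A)$ and $\mu_A\circ\Delta_A\circ m_A=m_A^3$. *)

(* Defs.v *)
From HB Require Import structures.
From mathcomp Require Import all_boot all_order all_algebra.
From mathcomp Require Import boolp.

Set Implicit Arguments.
Unset Strict Implicit.
Unset Printing Implicit Defensive.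

Import GRing.Theory.
Import VectorInternalTheory.
Local Open Scope ring_scope.

Record braidedCat := BraidedCat {
  ob :> Type;
  mor : ob -> ob -> Type;
  idm : forall A, mor A A;
  cmp : forall A B C, mor B C -> mor A B -> mor A C;
  tob : ob -> ob -> ob;
  tmor : forall A B A' B', mor A A' -> mor B B' -> mor (tob A B) (tob A' B');
  uob : ob;
  asc : forall A B C, mor (tob (tob A B) C) (tob A (tob B C));
  asc_inv : forall A B C, mor (tob A (tob B C)) (tob (tob A B) C);
  lun : forall A, mor (tob uob A) A;
  lun_inv : forall A, mor A (tob uob A);
  run : forall A, mor (tob A uob) A;
  run_inv : forall A, mor A (tob A uob);
  brd : forall A B, mor (tob A B) (tob B A);
  brd_inv : forall A B, mor (tob B A) (tob A B);

  cmpA : forall A B C D (f : mor C D) (g : mor B C) (h : mor A B),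
    cmp f (cmp g h) = cmp (cmp f g) h;
  cmp1m : forall A B (f : mor A B), cmp (idm B) f = f;
  cmpm1 : forall A B (f : mor A B), cmp f (idm A) = f;

  tmor_id : forall A B, tmor (idm A) (idm B) = idm (tob A B);
  tmor_cmp : forall A B C A' B' C' (f : mor B C) (g : mor A B)
      (f' : mor B' C') (g' : mor A' B'),
    tmor (cmp f g) (cmp f' g') = cmp (tmor f f') (tmor g g');

  ascK : forall A B C, cmp (asc_inv A B C) (asc A B C) = idm _;
  ascVK : forall A B C, cmp (asc A B C) (asc_inv A B C) = idm _;
  asc_nat : forall A B C A' B' C'
      (f : mor A A') (g : mor B B') (h : mor C C'),
    cmp (asc A' B' C') (tmor (tmor f g) h)
    = cmp (tmor f (tmor g h)) (asc A B C);

  lunK : forall A, cmp (lun_inv A) (lun A) = idm _;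
  lunVK : forall A, cmp (lun A) (lun_inv A) = idm _;
  lun_nat : forall A B (f : mor A B),
    cmp (lun B) (tmor (idm uob) f) = cmp f (lun A);
  runK : forall A, cmp (run_inv A) (run A) = idm _;
  runVK : forall A, cmp (run A) (run_inv A) = idm _;
  run_nat : forall A B (f : mor A B),
    cmp (run B) (tmor f (idm uob)) = cmp f (run A);

  pentagon : forall A B C D,
    cmp (asc A B (tob C D)) (asc (tob A B) C D)
    = cmp (tmor (idm A) (asc B C D))
          (cmp (asc A (tob B C) D) (tmor (asc A B C) (idm D)));
  triangle : forall A B,
    cmp (tmor (idm A) (lun B)) (asc A uob B) = tmor (run A) (idm B);

  brdK : forall A B, cmp (brd_inv A B) (brd A B) = idm _;
  brdVK : forall A B, cmp (brd A B) (brd_inv A B) = idm _;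
  brd_nat : forall A B A' B' (f : mor A A') (g : mor B B'),
    cmp (brd A' B') (tmor f g) = cmp (tmor g f) (brd A B);
  hexagon1 : forall A B C,
    cmp (asc B C A) (cmp (brd A (tob B C)) (asc A B C))
    = cmp (tmor (idm B) (brd A C))
          (cmp (asc B A C) (tmor (brd A B) (idm C)));
  hexagon2 : forall A B C,
    cmp (asc_inv C A B) (cmp (brd (tob A B) C) (asc_inv A B C))
    = cmp (tmor (brd A C) (idm B))
          (cmp (asc_inv A C B) (tmor (idm A) (brd B C)))
}.

Arguments idm {b} A.
Arguments cmp {b A B C} f g.
Arguments tob {b} A B.
Arguments tmor {b A B A' B'} f g.
Arguments uob {b}.
Arguments asc {b} A B C.
Arguments asc_inv {b} A B C.
Arguments lun {b} A.
Arguments run {b} A.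
Arguments brd {b} A B.

Section MobiusFrobenius.
Variables (C : braidedCat) (A : C).
Variables (mu : mor (tob A A) A) (eta : mor uob A).
Variables (Delta : mor A (tob A A)) (eps : mor A uob) (m : mor A A).

Local Notation "f 'oo' g" := (cmp f g) (at level 50, left associativity).
Local Notation "f 'ox' g" := (tmor f g) (at level 40, left associativity).

(* Unital and counital, with the Frobenius relation; commutativity is meant
   with respect to the braiding. *)
Record isFrobenius : Prop := {
  mu_assoc : mu oo (mu ox idm A) = mu oo (idm A ox mu) oo asc A A A;
  mu_unitl : mu oo (eta ox idm A) = lun A;
  mu_unitr : mu oo (idm A ox eta) = run A;
  Delta_coassoc :
    asc A A A oo (Delta ox idm A) oo Delta = (idm A ox Delta) oo Delta;
  Delta_counitl : lun A oo (eps ox idm A) oo Delta = idm A;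
  Delta_counitr : run A oo (idm A ox eps) oo Delta = idm A;
  frobeniusl :
    (mu ox idm A) oo asc_inv A A A oo (idm A ox Delta) = Delta oo mu;
  frobeniusr :
    (idm A ox mu) oo asc A A A oo (Delta ox idm A) = Delta oo mu
}.

Record isCommFrobenius : Prop := {
  comm_frobenius : isFrobenius;
  mu_comm : mu oo brd A A = mu
}.

Record isMobiusFrobenius : Prop := {
  mobius_comm_frobenius : isCommFrobenius;
  mobius_mul : mu oo (m ox idm A) = m oo mu;
  mobius_mur : m oo mu = mu oo (idm A ox m);
  mobius_cube : mu oo Delta oo m = m oo m oo m
}.

End MobiusFrobenius.

(* [vectType R] for a commutative ring [R] is exactly the finite-rank free
   R-modules (given with a linear bijection [v2r] to some ['rV[R]_(dim V)]),
   and ['Hom(U, V)] is the R-module of R-linear maps.  The tensor product is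
   realized on coordinate matrices; [tens_univ] is its universal property. *)
Section Tensor.
Variable R : comNzRingType.
Implicit Types U V W X Y : vectType R.

Definition tens U V : vectType R := 'M[R]_(dim U, dim V).

Definition pure U V (u : U) (v : V) : tens U V := (v2r u)^T *m v2r v.

Definition bilin U V W (f : U -> V -> W) : Prop :=
  (forall v, linear (f^~ v)) /\ (forall u, linear (f u)).

Definition evec U (i : 'I_(dim U)) : U := r2v (delta_mx 0 i).

Definition tlift U V W (f : U -> V -> W) : 'Hom(tens U V, W) :=
  linfun (fun t : tens U V => \sum_i \sum_j t i j *: f (evec i) (evec j)).

Lemma linE U V (f : U -> V) : linear f -> linfun f =1 f.
Proof.
move=> fl; pose f' := GRing.isLinear.Build R U V *:%R f fl.
pose F : {linear U -> V} := HB.pack f f'.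
exact: (lfunE F).
Qed.

Lemma evecE U (u : U) : u = \sum_i v2r u 0 i *: evec i.
Proof.
apply: (can_inj v2rK); rewrite linear_sum {1}(row_sum_delta (v2r u)).
by apply: eq_bigr => i _; rewrite linearZ /= r2vK.
Qed.

Lemma lin_sumZ U V (f : U -> V) (I : finType) (c : I -> R) (g : I -> U) :
  linear f -> f (\sum_i c i *: g i) = \sum_i c i *: f (g i).
Proof.
move=> fl; rewrite -!(linE fl) linear_sum; apply: eq_bigr => i _.
by rewrite linearZ /= (linE fl).
Qed.

Lemma pure_bilin U V : bilin (@pure U V).
Proof.
split=> [v|u] a x y; rewrite /pure linearP /=.
  by rewrite linearP mulmxDl -scalemxAl.
by rewrite mulmxDr -scalemxAr.
Qed.

Lemma tlift_linear U V W (f : U -> V -> W) :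
  linear (fun t : tens U V => \sum_i \sum_j t i j *: f (evec i) (evec j)).
Proof.
move=> a x y; rewrite scaler_sumr -big_split; apply: eq_bigr => i _ /=.
rewrite scaler_sumr -big_split; apply: eq_bigr => j _ /=.
by rewrite !mxE scalerDl scalerA.
Qed.

Lemma tliftE U V W (f : U -> V -> W) u v :
  bilin f -> tlift f (pure u v) = f u v.
Proof.
case=> fl fr; rewrite (linE (tlift_linear f)).
rewrite {2}(evecE u) (lin_sumZ (f := f^~ v)) //; apply: eq_bigr => i _.
rewrite {2}(evecE v) lin_sumZ // scaler_sumr; apply: eq_bigr => j _.
by rewrite !mxE big_ord1 !mxE scalerA.
Qed.

Lemma tens_ext U V W (f g : 'Hom(tens U V, W)) :
  (forall u v, f (pure u v) = g (pure u v)) -> f = g.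
Proof.
move=> fg; apply/lfunP => t; rewrite (matrix_sum_delta t) !linear_sum.
apply: eq_bigr => i _; rewrite !linear_sum; apply: eq_bigr => j _.
suff E : delta_mx i j = pure (evec i) (evec j) by rewrite E !linearZ /= fg.
by rewrite /pure !r2vK trmx_delta mul_delta_mx.
Qed.

Lemma tens_univ U V W (f : U -> V -> W) : bilin f ->
  exists! g : 'Hom(tens U V, W), forall u v, g (pure u v) = f u v.
Proof.
move=> fb; exists (tlift f); split=> [u v|g gE]; first exact: tliftE.
by apply: tens_ext => u v; rewrite tliftE.
Qed.

Definition tensm U V U' V' (f : 'Hom(U, U')) (g : 'Hom(V, V')) :
    'Hom(tens U V, tens U' V') :=
  tlift (fun u v => pure (f u) (g v)).

Definition tasc U V W : 'Hom(tens (tens U V) W, tens U (tens V W)) :=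
  tlift (fun t w => tlift (fun u v => pure u (pure v w)) t).

Definition tasc_inv U V W : 'Hom(tens U (tens V W), tens (tens U V) W) :=
  tlift (fun u t => tlift (fun v w => pure (pure u v) w) t).

Definition tunit : vectType R := R^o.

Definition tlun U : 'Hom(tens tunit U, U) :=
  tlift (fun (r : tunit) u => (r : R) *: u).
Definition tlun_inv U : 'Hom(U, tens tunit U) :=
  linfun (fun u => pure (1 : tunit) u).
Definition trun U : 'Hom(tens U tunit, U) :=
  tlift (fun u (r : tunit) => (r : R) *: u).
Definition trun_inv U : 'Hom(U, tens U tunit) :=
  linfun (fun u => pure u (1 : tunit)).

Definition tbrd U V : 'Hom(tens U V, tens V U) := tlift (fun u v => pure v u).

Definition pureL U V (u : U) : 'Hom(V, tens U V) := linfun (pure u).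
Definition pureR U V (v : V) : 'Hom(U, tens U V) := linfun ((@pure U V)^~ v).

Lemma pureLE U V (u : U) (v : V) : pureL V u v = pure u v.
Proof. by rewrite (linE ((pure_bilin U V).2 u)). Qed.
Lemma pureRE U V (u : U) (v : V) : pureR U v u = pure u v.
Proof. by rewrite (linE ((pure_bilin U V).1 v)). Qed.

Lemma tens_ext3l U V W X (f g : 'Hom(tens (tens U V) W, X)) :
  (forall u v w, f (pure (pure u v) w) = g (pure (pure u v) w)) -> f = g.
Proof.
move=> fg; apply: tens_ext => t w; rewrite -pureRE -!comp_lfunE.
by congr (fun_of_lfun _ t); apply: tens_ext => u v; rewrite !comp_lfunE pureRE.
Qed.

Lemma tens_ext3r U V W X (f g : 'Hom(tens U (tens V W), X)) :
  (forall u v w, f (pure u (pure v w)) = g (pure u (pure v w))) -> f = g.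
Proof.
move=> fg; apply: tens_ext => u t; rewrite -pureLE -!comp_lfunE.
by congr (fun_of_lfun _ t); apply: tens_ext => v w; rewrite !comp_lfunE pureLE.
Qed.

Lemma tens_ext4l U V W X Y (f g : 'Hom(tens (tens (tens U V) W) X, Y)) :
  (forall u v w x, f (pure (pure (pure u v) w) x)
                 = g (pure (pure (pure u v) w) x)) -> f = g.
Proof.
move=> fg; apply: tens_ext => t x; rewrite -pureRE -!comp_lfunE.
congr (fun_of_lfun _ t); apply: tens_ext3l => u v w.
by rewrite !comp_lfunE pureRE.
Qed.

Lemma pureDl U V (u u' : U) (v : V) a :
  pure (a *: u + u') v = a *: pure u v + pure u' v.
Proof. exact: (pure_bilin U V).1. Qed.
Lemma pureDr U V (u : U) (v v' : V) a :
  pure u (a *: v + v') = a *: pure u v + pure u v'.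
Proof. exact: (pure_bilin U V).2. Qed.
Lemma pureZl U V (u : U) (v : V) a : pure (a *: u) v = a *: pure u v.
Proof. by rewrite -!pureRE linearZ. Qed.
Lemma pureZr U V (u : U) (v : V) a : pure u (a *: v) = a *: pure u v.
Proof. by rewrite -!pureLE linearZ. Qed.

Lemma tensmE U V U' V' (f : 'Hom(U, U')) (g : 'Hom(V, V')) u v :
  tensm f g (pure u v) = pure (f u) (g v).
Proof.
by apply: tliftE; split=> z a x y; rewrite linearP ?pureDl ?pureDr.
Qed.

Lemma tascE U V W (u : U) (v : V) (w : W) :
  tasc U V W (pure (pure u v) w) = pure u (pure v w).
Proof.
have B w' : bilin (fun (u : U) (v : V) => pure u (pure v w')).
  by split=> z a x y; rewrite ?pureDl ?pureDr.
rewrite /tasc tliftE; first by rewrite tliftE.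
split=> [z|t] a x y; first exact: linearP.
rewrite -[in RHS]scale_lfunE -add_lfunE; congr (fun_of_lfun _ t).
apply: tens_ext => u' v'.
by rewrite add_lfunE scale_lfunE !tliftE // !pureDr.
Qed.

Lemma tasc_invE U V W (u : U) (v : V) (w : W) :
  tasc_inv U V W (pure u (pure v w)) = pure (pure u v) w.
Proof.
have B u' : bilin (fun (v : V) (w : W) => pure (pure u' v) w).
  by split=> z a x y; rewrite ?pureDr ?pureDl.
rewrite /tasc_inv tliftE; first by rewrite tliftE.
split=> [t|z] a x y; last exact: linearP.
rewrite -[in RHS]scale_lfunE -add_lfunE; congr (fun_of_lfun _ t).
apply: tens_ext => v' w'.
by rewrite add_lfunE scale_lfunE !tliftE // !pureDl.
Qed.

Lemma tlunE U (r : tunit) (u : U) : tlun U (pure r u) = (r : R) *: u.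
Proof.
apply: tliftE; split=> z a x y; first by rewrite scalerDl scalerA.
by rewrite scalerDr !scalerA mulrC.
Qed.
Lemma trunE U (r : tunit) (u : U) : trun U (pure u r) = (r : R) *: u.
Proof.
apply: tliftE; split=> z a x y; last by rewrite scalerDl scalerA.
by rewrite scalerDr !scalerA mulrC.
Qed.
Lemma tlun_invE U (u : U) : tlun_inv U u = pure (1 : tunit) u.
Proof. exact: pureLE. Qed.
Lemma trun_invE U (u : U) : trun_inv U u = pure u (1 : tunit).
Proof. exact: pureRE. Qed.

Lemma tbrdE U V (u : U) (v : V) : tbrd U V (pure u v) = pure v u.
Proof. by apply: tliftE; split=> z a x y; rewrite ?pureDl ?pureDr. Qed.

Lemma pure_unitl U (r : tunit) (u : U) :
  pure (1 : tunit) ((r : R) *: u) = pure r u.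
Proof. by rewrite pureZr -pureZl; congr pure; exact: mulr1. Qed.
Lemma pure_unitr U (r : tunit) (u : U) :
  pure ((r : R) *: u) (1 : tunit) = pure u r.
Proof. by rewrite pureZl -pureZr; congr pure; exact: mulr1. Qed.
Lemma pure_mid U V (u : U) (r : tunit) (v : V) :
  pure u ((r : R) *: v) = pure ((r : R) *: u) v.
Proof. by rewrite pureZr pureZl. Qed.

Definition tensE := (comp_lfunE, id_lfunE, tensmE, tascE, tasc_invE, tlunE,
  trunE, tlun_invE, trun_invE, tbrdE).

Definition RMod : braidedCat.
refine (@BraidedCat (vectType R) (fun U V => 'Hom(U, V))
  (fun U => \1%VF) (fun U V W g f => (g \o f)%VF)
  tens tensm tunit tasc tasc_inv tlun tlun_inv trun trun_inv
  tbrd (fun U V => tbrd V U)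
  _ _ _ _ _ _ _ _ _ _ _ _ _ _ _ _ _ _ _ _ _).
- by move=> *; rewrite comp_lfunA.
- by move=> *; rewrite comp_lfun1l.
- by move=> *; rewrite comp_lfun1r.
- by move=> *; apply: tens_ext => *; rewrite !tensE.
- by move=> *; apply: tens_ext => *; rewrite !tensE.
- by move=> *; apply: tens_ext3l => *; rewrite !tensE.
- by move=> *; apply: tens_ext3r => *; rewrite !tensE.
- by move=> *; apply: tens_ext3l => *; rewrite !tensE.
- by move=> *; apply: tens_ext => *; rewrite !tensE pure_unitl.
- by move=> U; apply/lfunP => u; rewrite !tensE scale1r.
- by move=> *; apply: tens_ext => *; rewrite !tensE linearZ.
- by move=> *; apply: tens_ext => *; rewrite !tensE pure_unitr.
- by move=> U; apply/lfunP => u; rewrite !tensE scale1r.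
- by move=> *; apply: tens_ext => *; rewrite !tensE linearZ.
- by move=> *; apply: tens_ext4l => *; rewrite !tensE.
- by move=> *; apply: tens_ext3l => *; rewrite !tensE pure_mid.
- by move=> *; apply: tens_ext => *; rewrite !tensE.
- by move=> *; apply: tens_ext => *; rewrite !tensE.
- by move=> *; apply: tens_ext => *; rewrite !tensE.
- by move=> *; apply: tens_ext3l => *; rewrite !tensE.
- by move=> *; apply: tens_ext3r => *; rewrite !tensE.
Defined.

Lemma RMod_symmetric (A B : RMod) : cmp (brd B A) (brd A B) = idm (tob A B).
Proof. exact: (brdK A B). Qed.

End Tensor.

Notation "u '*t' v" := (pure u v) (at level 40, left associativity).

(* Z[1/N], as the subring of the rationals generated by 1/N. *)
Definition inZinv (N : nat) : {pred rat} :=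
  [pred q | `[< exists p : {poly int}, q = (map_poly intr p).[N%:R^-1] >]].

Lemma inZinvP N q :
  reflect (exists p : {poly int}, q = (map_poly intr p).[N%:R^-1])
          (q \in inZinv N).
Proof. exact: asboolP. Qed.

Lemma inZinv_subring N : subring_closed (inZinv N).
Proof.
split=> [|u v /inZinvP[p ->] /inZinvP[q ->]|u v /inZinvP[p ->] /inZinvP[q ->]];
  apply/inZinvP.
- by exists 1; rewrite rmorph1 hornerC.
- by exists (p - q); rewrite rmorphB !hornerE.
- by exists (p * q); rewrite rmorphM hornerM.
Qed.

HB.instance Definition _ N :=
  GRing.isSubringClosed.Build rat (inZinv N) (inZinv_subring N).

Record Zinv (N : nat) := MkZinv { Zinv_val : rat; _ : Zinv_val \in inZinv N }.

HB.instance Definition _ N := [isSub for @Zinv_val N].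
HB.instance Definition _ N := [Choice of Zinv N by <:].
HB.instance Definition _ N := [SubChoice_isSubComNzRing of Zinv N by <:].

Lemma inv_inZinv N : N%:R^-1 \in inZinv N.
Proof. by apply/inZinvP; exists 'X; rewrite map_polyX hornerX. Qed.

Definition invN (N : nat) : Zinv N := MkZinv (inv_inZinv N).

Lemma invNK N : (0 < N)%N -> N%:R * invN N = 1.
Proof.
move=> N_gt0; apply: val_inj; rewrite rmorphM rmorph_nat rmorph1 /= divff //.
by rewrite Num.Theory.pnatr_eq0 -lt0n.
Qed.

(* R[x, y] is {poly {poly R}}, with y the outer variable 'X and x the inner
   one, i.e. 'X%:P. *)
Section Quotient.
Variables (R : comNzRingType) (n : nat) (n_gt0 : (0 < n)%N).
Implicit Types (p q : {poly {poly R}}) (a : R).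

Definition polyx : {poly {poly R}} := 'X%:P.
Definition polyy : {poly {poly R}} := 'X.
Definition relxy : {poly {poly R}} := polyy ^+ 3 - polyx * polyy.

Definition relIdeal of (0 < n)%N : {pred {poly {poly R}}} :=
  [pred p | `[< exists u v, p = u * polyx ^+ n + v * relxy >]].
Local Notation I := (relIdeal n_gt0).

Lemma relIdealP p :
  reflect (exists u v, p = u * polyx ^+ n + v * relxy) (p \in I).
Proof. exact: asboolP. Qed.

Lemma relIdeal_closed : idealr_closed I.
Proof.
split=> [||c _ _ /relIdealP[a [b ->]] /relIdealP[a' [b' ->]]].
- by apply/relIdealP; exists 0, 0; rewrite !mul0r addr0.
- apply/relIdealP => -[a [b /(congr1 (fun p => p.[0].[0]))]].
  have -> : relxy = polyy * (polyy ^+ 2 - polyx).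
    by rewrite mulrBr -exprS [polyy * polyx]mulrC.
  rewrite /polyx /polyy !(hornerE, horner_exp) /= expr0n eqn0Ngt n_gt0 /=.
  by rewrite !(mulr0, mul0r, addr0, hornerE) => /eqP; rewrite oner_eq0.
- apply/relIdealP; exists (c * a + a'), (c * b + b').
  by rewrite mulrDr !mulrA !mulrDl addrACA.
Qed.

HB.instance Definition _ :=
  isIdealr.Build {poly {poly R}} I relIdeal_closed.

Definition quotXY : Type := {ideal_quot I}.

HB.instance Definition _ := GRing.ComNzRing.on quotXY.
HB.instance Definition _ := EqQuotient.on quotXY.

Definition toq (p : {poly {poly R}}) : quotXY := (\pi_{ideal_quot I} p)%qT.

Lemma toq_zmod : zmod_morphism toq. Proof. by move=> p q; exact: rmorphB. Qed.
Lemma toq_monoid : monoid_morphism toq.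
Proof. by split=> [|p q]; [exact: rmorph1 | exact: rmorphM]. Qed.
HB.instance Definition _ :=
  GRing.isZmodMorphism.Build {poly {poly R}} quotXY toq toq_zmod.
HB.instance Definition _ :=
  GRing.isMonoidMorphism.Build {poly {poly R}} quotXY toq toq_monoid.

Lemma toq_eq p q : reflect (toq p = toq q) (p - q \in I).
Proof. by rewrite Quotient.idealrBE; apply: eqP. Qed.

Lemma toq_surj (v : quotXY) : exists p, v = toq p.
Proof. by exists (repr v); rewrite /toq reprK. Qed.

Definition qscale a (v : quotXY) : quotXY := toq a%:P%:P * v.
Lemma qscaleA a b v : qscale a (qscale b v) = qscale (a * b) v.
Proof. by rewrite /qscale !rmorphM mulrA. Qed.
Lemma qscale1 : left_id 1 qscale.
Proof. by move=> v; rewrite /qscale !rmorph1 mul1r. Qed.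
Lemma qscaleDr : right_distributive qscale +%R.
Proof. by move=> a u v; rewrite /qscale mulrDr. Qed.
Lemma qscaleDl v : {morph qscale^~ v : a b / a + b}.
Proof. by move=> a b; rewrite /qscale !rmorphD mulrDl. Qed.
HB.instance Definition _ := GRing.Zmodule_isLmodule.Build R quotXY
  qscaleA qscale1 qscaleDr qscaleDl.

Lemma qscaleAl a (u v : quotXY) : a *: (u * v) = (a *: u) * v.
Proof. exact: mulrA. Qed.
HB.instance Definition _ := GRing.Lmodule_isLalgebra.Build R quotXY qscaleAl.
HB.instance Definition _ := GRing.Lalgebra_isComAlgebra.Build R quotXY.

Definition xV : quotXY := toq polyx.
Definition yV : quotXY := toq polyy.

Lemma xVn : xV ^+ n = 0.
Proof.
rewrite -(rmorph0 toq) -rmorphXn /=; apply/toq_eq/relIdealP.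
by exists 1, 0; rewrite subr0 mul1r mul0r addr0.
Qed.

Lemma yV3 : yV ^+ 3 = xV * yV.
Proof.
rewrite -rmorphXn -rmorphM /=; apply/toq_eq/relIdealP.
by exists 0, 1; rewrite mul0r mul1r add0r.
Qed.

Import Pdiv.Ring Pdiv.RingMonic.

Lemma size_relxy : size relxy = 4.
Proof.
rewrite /relxy size_polyDl size_polyXn // size_polyN /polyx mul_polyC.
by apply: leq_ltn_trans (size_scale_leq _ _) _; rewrite size_polyX.
Qed.

Lemma monic_relxy : relxy \is monic.
Proof.
rewrite monicE lead_coefE size_relxy /= /relxy /polyx mul_polyC.
by rewrite coefB coefZ coefXn coefX mulr0 subr0.
Qed.

Lemma polyxX k : polyx ^+ k = ('X^k)%:P.
Proof. by rewrite rmorphXn. Qed.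

(* Reduction modulo the monic (in y) polynomial y^3 - xy, then x^n = 0. *)
Definition nf p : 'M[R]_(n, 3) := \matrix_(i, j) (rmodp p relxy)`_j`_i.

Lemma nfB p q : nf (p - q) = nf p - nf q.
Proof. by apply/matrixP=> i j; rewrite !mxE rmodpB ?monic_relxy // !coefB. Qed.

Lemma nfZ a p : nf (a%:P *: p) = a *: nf p.
Proof.
by apply/matrixP=> i j; rewrite !mxE rmodpZ ?monic_relxy // coefZ coefCM.
Qed.

Lemma rmodp_polyx k p : rmodp (p * polyx ^+ k) relxy = 'X^k *: rmodp p relxy.
Proof. by rewrite mulrC polyxX mul_polyC rmodpZ ?monic_relxy. Qed.

Lemma nfI p : p \in I -> nf p = 0.
Proof.
case/relIdealP=> a [b ->]; apply/matrixP=> i j; rewrite !mxE.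
rewrite rmodpD ?monic_relxy // (rmodp_mull monic_relxy) addr0.
by rewrite rmodp_polyx coefZ mulrC coefMXn ltn_ord.
Qed.

Definition coordV (v : quotXY) : 'M[R]_(n, 3) := nf (repr v).

Lemma coordV_toq p : coordV (toq p) = nf p.
Proof.
apply/eqP; rewrite -subr_eq0 -nfB nfI //; apply/toq_eq.
by rewrite /toq reprK.
Qed.

Lemma coordV_linear : linear coordV.
Proof.
move=> a u v; case: (toq_surj u) (toq_surj v) => p -> [q ->].
have -> : a *: toq p + toq q = toq (a%:P *: p - (- q)).
  by rewrite opprK rmorphD -mul_polyC rmorphM.
have nfN r : nf (- r) = - nf r.
  by rewrite -[- r]add0r nfB -(subrr 0) nfB subrr add0r.
by rewrite !coordV_toq nfB nfZ nfN opprK.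
Qed.
HB.instance Definition _ :=
  GRing.isLinear.Build R quotXY 'M[R]_(n, 3) *:%R coordV coordV_linear.

Lemma coordV_mon (i : 'I_n) (j : 'I_3) :
  coordV (xV ^+ i * yV ^+ j) = delta_mx i j.
Proof.
rewrite -!(rmorphXn toq) -rmorphM /= coordV_toq.
apply/matrixP=> k l; rewrite !mxE.
rewrite polyxX mul_polyC rmodp_small.
  rewrite coefZ coefXn -!val_eqE /=; case: eqP => _; rewrite ?andbF ?mulr0 ?coef0 //.
  by rewrite mulr1 coefXn andbT.
apply: leq_ltn_trans (size_scale_leq _ _) _.
by rewrite size_polyXn size_relxy ltnS ltn_ord.
Qed.

Lemma toqC (c : {poly R}) : toq c%:P = \sum_(i < n) c`_i *: xV ^+ i.
Proof.
rewrite -[in LHS](poly_take_drop n c) rmorphD rmorphM /= rmorphXn /=.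
rewrite rmorphD rmorphM rmorphXn /= -/xV xVn mulr0 addr0 /take_poly poly_def.
rewrite !rmorph_sum; apply: eq_bigr => i _ /=.
by rewrite -mul_polyC !rmorphM !rmorphXn.
Qed.

Lemma coordVE v :
  v = \sum_(i < n) \sum_(j < 3) coordV v i j *: (xV ^+ i * yV ^+ j).
Proof.
case: (toq_surj v) => p ->; rewrite coordV_toq exchange_big /=.
have -> : toq p = toq (rmodp p relxy).
  apply/toq_eq/relIdealP; exists 0, (rdivp p relxy).
  by rewrite {1}(rdivp_eq monic_relxy p) addrK mul0r add0r.
have sz : (size (rmodp p relxy) <= 3)%N.
  have : (size (rmodp p relxy) < size relxy)%N.
    by rewrite ltn_rmodp monic_neq0 ?monic_relxy.
  by rewrite size_relxy.
have {1}-> : rmodp p relxy = \sum_(j < 3) (rmodp p relxy)`_j *: 'X^j.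
  by rewrite -poly_def; apply/esym/polyP => k; rewrite coef_poly;
     case: ltnP => // /(leq_trans sz) /leq_sizeP->.
rewrite rmorph_sum; apply: eq_bigr => j _.
rewrite -mul_polyC rmorphM rmorphXn /= -/yV toqC mulr_suml.
by apply: eq_bigr => i _; rewrite mxE scalerAl.
Qed.

Lemma coordV_bij : bijective coordV.
Proof.
exists (fun M : 'M[R]_(n, 3) =>
  \sum_(i < n) \sum_(j < 3) M i j *: (xV ^+ i * yV ^+ j)) => [v|M].
  by rewrite -coordVE.
rewrite linear_sum [RHS]matrix_sum_delta; apply: eq_bigr => i _.
rewrite linear_sum; apply: eq_bigr => j _.
by rewrite linearZ /= coordV_mon.
Qed.

Lemma quotXY_vect : vector_axiom_def (n * 3) quotXY.
Proof.
exists (mxvec \o coordV); first by move=> a u v /=; rewrite !linearP.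
by apply: bij_comp coordV_bij; exists vec_mx; [exact: mxvecK | exact: vec_mxK].
Qed.
HB.instance Definition _ := Lmodule_hasFinDim.Build R quotXY quotXY_vect.

Lemma mon_basis (v : quotXY) : exists! c : 'M[R]_(n, 3),
  v = \sum_(i < n) \sum_(j < 3) c i j *: (xV ^+ i * yV ^+ j).
Proof.
exists (coordV v); split=> [|c ->]; first exact: coordVE.
rewrite linear_sum [RHS]matrix_sum_delta; apply: eq_bigr => i _.
rewrite linear_sum; apply: eq_bigr => j _.
by rewrite linearZ /= coordV_mon.
Qed.

End Quotient.

Section Structure.
(* In [DeltaV_fun], [c] stands for 1/(3n). *)
Variables (R : comNzRingType) (n : nat) (n_gt0 : (0 < n)%N) (c : R).

(* [quotXY] with the rank-3n free module structure given by the basis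
   x^i y^j, i < n, j < 3. *)
Definition V : vectType R := quotXY R n_gt0.

Local Notation x := (xV R n_gt0).
Local Notation y := (yV R n_gt0).

Definition muV : 'Hom(tens V V, V) :=
  tlift (fun u v : quotXY R n_gt0 => u * v : V).

Definition etaV : 'Hom(tunit R, V) :=
  linfun (fun r : tunit R => (r : R)%:A : quotXY R n_gt0).

(* The linear extension of x^i y^j |-> 3n if (i, j) = (n - 1, 2), else 0. *)
Definition epsV : 'Hom(V, tunit R) :=
  linfun (fun v : V => (\sum_(i < n) \sum_(j < 3) coordV v i j *
    (if (i == n.-1 :> nat) && (j == 2 :> nat) then (3 * n)%:R else 0)) : tunit R).

Definition DeltaV_fun (v : quotXY R n_gt0) : tens V V :=
  - c *: (\sum_(i < n.+1) \sum_(j < n.+1 | [&& i + j == n, 0 < i & 0 < j]%N)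
      (v * x ^+ i : V) *t (x ^+ j : V))
  + c *: (\sum_(i < n) \sum_(j < n | (i + j == n.-1)%N)
      ((v * x ^+ i * y ^+ 2 : V) *t (x ^+ j : V)
       + (v * x ^+ i * y : V) *t (x ^+ j * y : V)
       + (v * x ^+ i : V) *t (x ^+ j * y ^+ 2 : V))).
Definition DeltaV : 'Hom(V, tens V V) := linfun (DeltaV_fun : V -> _).

Definition mV_fun (v : quotXY R n_gt0) : V :=
  if odd n then v * x ^+ n.-1./2 * y else v * x ^+ n.-2./2 * y ^+ 2.
Definition mV : 'Hom(V, V) := linfun (mV_fun : V -> V).

(* [linfun f] agrees with [f] only when [f] is linear; this is checked below. *)
Lemma muVE (u v : quotXY R n_gt0) : muV ((u : V) *t (v : V)) = u * v.
Proof.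
apply: tliftE; split=> z a s t; first by rewrite mulrDl scalerAl.
by rewrite mulrDr scalerAr.
Qed.

Lemma etaVE (r : R) : etaV (r : tunit R) = toq n_gt0 r%:P%:P.
Proof.
rewrite linE; first by rewrite /GRing.scale /= /qscale mulr1.
by move=> a s t; rewrite scalerDl scalerA.
Qed.

Lemma epsVE (i : 'I_n) (j : 'I_3) :
  epsV (x ^+ i * y ^+ j) =
    (if (i == n.-1 :> nat) && (j == 2 :> nat) then (3 * n)%:R else 0) :> R.
Proof.
rewrite linE => [|a s t]; last first.
  rewrite linearP scaler_sumr -big_split; apply: eq_bigr => k _ /=.
  rewrite scaler_sumr -big_split; apply: eq_bigr => l _ /=.
  by rewrite !mxE mulrDl -mulrA.
rewrite coordV_mon (bigD1 i) //= (bigD1 j) //= !mxE !eqxx mul1r !big1 ?addr0 //.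
  by move=> k /negPf ki; rewrite big1 // => l _; rewrite mxE ki mul0r.
by move=> l /negPf lj; rewrite mxE lj andbF mul0r.
Qed.

Lemma DeltaVE (v : V) : DeltaV v = DeltaV_fun v.
Proof.
have addZ3 (M : lmodType R) (a : R) (p1 q1 p2 q2 p3 q3 : M) :
    (a *: p1 + q1) + (a *: p2 + q2) + (a *: p3 + q3)
    = a *: (p1 + p2 + p3) + (q1 + q2 + q3).
  by rewrite (addrACA (a *: p1)) (addrACA (_ + _)) -!scalerDr.
have comb (M : lmodType R) (a b : R) (p1 q1 p2 q2 : M) :
    - b *: (a *: p1 + q1) + b *: (a *: p2 + q2)
    = a *: (- b *: p1 + b *: p2) + (- b *: q1 + b *: q2).
  by rewrite !scalerDr addrACA !scalerA ![a * _]mulrC.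
apply: linE => a s t; rewrite /DeltaV_fun -comb; congr (_ *: _ + _ *: _).
  rewrite scaler_sumr -big_split; apply: eq_bigr => i _ /=.
  rewrite scaler_sumr -big_split; apply: eq_bigr => j _ /=.
  by rewrite mulrDl -scalerAl pureDl.
rewrite scaler_sumr -big_split; apply: eq_bigr => i _ /=.
rewrite scaler_sumr -big_split; apply: eq_bigr => j _ /=.
by rewrite !mulrDl -!scalerAl !pureDl addZ3.
Qed.

Lemma mVE (v : V) : mV v = mV_fun v.
Proof.
apply: linE => a s t; rewrite /mV_fun.
by case: ifP => _; rewrite !mulrDl -!scalerAl.
Qed.

End Structure.

(* Main.v *)
(* Put S = sum_(i + j = n - 1) x^i ⊗ x^j in V ⊗ V.  Since x^n = 0, one has
   (x ⊗ 1) S = (1 ⊗ x) S, and the first sum in the formula for Delta(1) is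
   (x ⊗ 1) S; hence
     3n Delta(1) = (y^2 ⊗ 1 + y ⊗ y + 1 ⊗ y^2 - x ⊗ 1) S.
   From y^3 = xy it follows that (y ⊗ 1) Delta(1) = (1 ⊗ y) Delta(1), so Delta
   is a map of V-bimodules.  This gives the Frobenius relations and
   coassociativity, and reduces the counit laws to v = 1.  Finally
   mu(S) = n x^(n-1), so mu Delta is multiplication by x^(n-1) y^2 = m(1)^2. *)
Require Import Defs.
From mathcomp Require Import all_boot all_order all_algebra.

Set Implicit Arguments.
Unset Strict Implicit.
Unset Printing Implicit Defensive.

Import GRing.Theory.
Local Open Scope ring_scope.

(** Grouping coordinates by rows leaves a single summation index, as in Sweedler notation. *)
Lemma tens_pureE (R : comNzRingType) (U W : vectType R) (t : tens U W) :
  t = \sum_i pure (evec i) (\sum_j t i j *: evec j).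
Proof.
rewrite {1}(matrix_sum_delta t); apply: eq_bigr => i _.
rewrite -pureLE linear_sum; apply: eq_bigr => j _.
by rewrite linearZ /= pureLE /pure !VectorInternalTheory.r2vK trmx_delta
  mul_delta_mx.
Qed.

Section Frobenius.
Variables (R : comNzRingType) (n : nat) (n_gt0 : (0 < n)%N) (c : R).

Local Notation A := (quotXY R n_gt0).
Local Notation VV := (V R n_gt0).
Local Notation x := (xV R n_gt0).
Local Notation y := (yV R n_gt0).
Local Notation Delta := (DeltaV n_gt0 c).
Local Notation eps := (epsV R n_gt0).
Implicit Types (p q u v w z : A).

(** The classes of x and y generate V as an R-algebra, so a property stable under linear
    combinations and products need only be checked at 1, x and y. *)
Lemma quotXY_ind (Q : A -> Prop) :
    (forall a u v, Q u -> Q v -> Q (a *: u + v)) ->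
    (forall u v, Q u -> Q v -> Q (u * v)) ->
    Q 1 -> Q x -> Q y -> forall v, Q v.
Proof.
move=> QL QM Q1 Qx Qy v.
have Q0 : Q 0 by rewrite -(addNr 1) -scaleN1r; apply: QL.
have QX u k : Q u -> Q (u ^+ k).
  by move=> Qu; elim: k => [|k IHk]; rewrite ?expr0 // exprS; apply: QM.
have QD u w : Q u -> Q w -> Q (u + w).
  by move=> Qu Qw; rewrite -[u]scale1r; apply: QL.
rewrite (coordVE v); apply: big_ind => // i _; apply: big_ind => // j _.
by rewrite -[_ *: _]addr0; apply: QL => //; apply: QM; apply: QX.
Qed.

(* [(p ⊗ q) S] *)
Definition xtens p q : tens VV VV :=
  \sum_(i < n) pure (p * x ^+ i : VV) (x ^+ (n.-1 - i) * q : VV).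

(** Up to p and q, both sides run over x^i ⊗ x^j with i + j = n; the last term on the left and the
    first on the right contain x^n = 0. *)
Lemma xtensx p q : xtens (p * x) q = xtens p (x * q).
Proof.
rewrite /xtens; case: n n_gt0 p q => // k k_gt0 p q /=.
rewrite big_ord_recr big_ord_recl /= subnn subn0.
rewrite -[p * _ * _ ^+ k]mulrA -exprS xVn mulr0.
rewrite [_ ^+ k * (_ * _)]mulrA -exprSr xVn mul0r.
rewrite -[X in _ + X = _]pureRE linear0 -[X in _ = X + _]pureLE linear0.
rewrite addr0 add0r.
apply: eq_bigr => i _; rewrite -mulrA -exprS /bump /= add1n; congr pure.
by rewrite [RHS]mulrA -exprSr subnSK.
Qed.

Lemma Delta_xtens v :
  Delta v = c *: (xtens (v * y ^+ 2) 1 + xtens (v * y) y + xtens v (y ^+ 2)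
                  - xtens (v * x) 1).
Proof.
rewrite DeltaVE /DeltaV_fun scaleNr addrC -scalerBr; congr (_ *: (_ - _)).
  rewrite /xtens -!big_split; apply: eq_bigr => i _ /=.
  have lt_in := ltn_ord i.
  have ltn' : (n.-1 - i < n)%N.
    by rewrite (leq_ltn_trans (leq_subr _ _)) ?ltn_predL.
  rewrite (big_pred1 (Ordinal ltn')) => [|j] /=.
    by rewrite mulr1 [_ * y ^+ 2 * _]mulrAC [v * y * _]mulrAC.
  rewrite -val_eqE /= -[X in _ == X](subnKC (_ : i <= n.-1)%N) ?eqn_add2l //.
  by rewrite -ltnS prednK.
rewrite /xtens big_ord_recl big1 ?add0r => [|j]; last by rewrite andbF.
apply: eq_bigr => i _; rewrite /= /bump add1n /=.
case: (ltnP i.+1 n) => [lt_in|le_ni].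
  have ltn' : (n.-1 - i < n.+1)%N.
    by rewrite ltnS (leq_trans (leq_subr _ _)) ?leq_pred.
  rewrite (big_pred1 (Ordinal ltn')) => [|j] /=.
    by rewrite mulr1 exprS mulrA.
  rewrite -val_eqE /= -[X in _ == X](subnKC (_ : i.+1 <= n)%N) ?(ltnW lt_in) //.
  rewrite eqn_add2l -subn1 -subnDA add1n.
  by case: (altP (_ =P _)) => [->|//]; rewrite subn_gt0.
(* Here i + 1 = n: the right-hand term contains x^n, while on the left the only solution j = 0 is
   excluded. *)
have -> : v * x * x ^+ i = 0.
  rewrite -mulrA -exprS (_ : i.+1 = n) ?xVn ?mulr0 //.
  by apply/eqP; rewrite eqn_leq ltn_ord.
rewrite -pureRE linear0 big1 // => j /andP[/eqP ijn j_gt0].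
have : (i.+1 < n)%N.
  by rewrite -[X in (_ < X)%N]ijn -[X in (X < _)%N]addn0 ltn_add2l.
by rewrite ltnNge le_ni.
Qed.

(* [3n (v ⊗ w) Delta(1)] *)
Definition copair v w : tens VV VV :=
  xtens (v * y ^+ 2) w + xtens (v * y) (y * w) + xtens v (y ^+ 2 * w)
  - xtens (v * x) w.

Lemma Delta_copair v : Delta v = c *: copair v 1.
Proof. by rewrite Delta_xtens /copair !mulr1. Qed.

Definition lmul v : 'Hom(VV, VV) := linfun (fun u : VV => (v * (u : A) : VV)).

Lemma lmulE v u : lmul v u = v * u.
Proof. by apply: linE => a s t; rewrite mulrDr scalerAr. Qed.

Lemma tensm_copair v w :
  tensm (lmul v) (lmul w) (copair 1 1) = copair v w.
Proof.
have E p q : tensm (lmul v) (lmul w) (xtens p q) = xtens (v * p) (w * q).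
  rewrite linear_sum; apply: eq_bigr => i _ /=.
  by rewrite tensmE !lmulE mulrA [w * _]mulrCA.
by rewrite /copair linearB !linearD /= !E !mul1r !mulr1 ![w * _]mulrC.
Qed.

(** One decomposition of [copair 1 1] serves every v and w, since these only multiply its two
    factors. *)
Lemma copair_sum : exists a b : 'I_(dim VV) -> A, forall v w,
  copair v w = \sum_k pure (v * a k : VV) (w * b k : VV).
Proof.
exists (fun i => evec i), (fun i => \sum_j copair 1 1 i j *: evec j) => v w.
rewrite -tensm_copair [copair 1 1 in LHS]tens_pureE linear_sum.
by apply: eq_bigr => k _ /=; rewrite tensmE !lmulE.
Qed.

(** The elements z that can be moved across form a subalgebra, so x and y suffice; x is handled by
    [xtensx]. *)
Lemma copairM z v w : copair (v * z) w = copair v (z * w).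
Proof.
have [a [b ab]] := copair_sum.
elim/quotXY_ind: z v w => [e s t IHs IHt|s t IHs IHt|||] v w.
- transitivity (e *: copair (v * s) w + copair (v * t) w).
    rewrite !ab scaler_sumr -big_split; apply: eq_bigr => k _ /=.
    by rewrite mulrDr mulrDl -scalerAr -scalerAl pureDl.
  rewrite IHs IHt !ab scaler_sumr -big_split; apply: eq_bigr => k _ /=.
  by rewrite !mulrDl -!scalerAl pureDr.
- by rewrite mulrA IHt IHs mulrA.
- by rewrite mulr1 mul1r.
- rewrite /copair [v * x * y ^+ 2]mulrAC [v * x * y]mulrAC !xtensx.
  by rewrite [x * (y * w)]mulrCA [x * (y ^+ 2 * w)]mulrCA.
(* On the left y^3 ⊗ 1 cancels xy ⊗ 1; on the right 1 ⊗ y^3 cancels x ⊗ y once x is moved across S.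
   Both sides leave y^2 ⊗ y + y ⊗ y^2. *)
- have yy2 : y * y ^+ 2 = x * y by rewrite -exprS yV3.
  rewrite /copair -[v * y * y ^+ 2]mulrA yy2 -[v * y * x]mulrA [y * x]mulrC.
  rewrite -[v * y * y]mulrA -expr2 [y ^+ 2 * (y * w)]mulrA.
  rewrite [y ^+ 2 * y]mulrC yy2.
  rewrite [y * (y * w)]mulrA -expr2 -[x * y * w]mulrA -xtensx addrK.
  by rewrite -[X in X - _ = _]addrA [LHS]addrC addKr.
Qed.

(** Sweedler form of the bimodule property, with c absorbed into b; the second clause moves z
    between the two factors. *)
Lemma Delta_sum : exists a b : 'I_(dim VV) -> A,
  (forall v, Delta v = \sum_k pure (v * a k : VV) (b k : VV)) /\
  (forall v z, \sum_k pure (v * z * a k : VV) (b k : VV)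
             = \sum_k pure (v * a k : VV) (z * b k : VV)).
Proof.
have [a [b ab]] := copair_sum.
have abE v w :
    c *: copair v w = \sum_k pure (v * a k : VV) (w * (c *: b k) : VV).
  rewrite ab scaler_sumr; apply: eq_bigr => k _.
  by rewrite -pureZr scalerAr.
exists a, (fun k => c *: b k); split=> [v|v z].
  by rewrite Delta_copair abE; apply: eq_bigr => k _; rewrite mul1r.
under eq_bigr do rewrite -[_ *: _]mul1r.
by rewrite -!abE copairM mulr1.
Qed.

Lemma eps_mon i j : (i < n)%N -> (j < 3)%N ->
  epsV R n_gt0 (x ^+ i * y ^+ j)
    = ((i == n.-1) && (j == 2))%:R * (3 * n)%:R :> R.
Proof.
move=> lt_in lt_j3; rewrite (epsVE R n_gt0 (Ordinal lt_in) (Ordinal lt_j3)) /=.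
by case: ifP => _; rewrite ?mul1r ?mul0r.
Qed.

Lemma muV_xtens p q : muV R n_gt0 (xtens p q) = n%:R *: (p * q * x ^+ n.-1).
Proof.
rewrite linear_sum (eq_bigr (fun=> p * q * x ^+ n.-1)) => [|i _ /=].
  by rewrite sumr_const card_ord scaler_nat.
have le_in : (i <= n.-1)%N by rewrite -ltnS prednK.
by rewrite muVE -{2}(subnKC le_in) exprD [_ * q]mulrC mulrACA.
Qed.

(** Each of the three y-terms contributes n x^(n-1) y^2 and the x-term contains x^n = 0, so the
    total factor 3n cancels c. *)
Lemma muV_Delta v : (3 * n)%:R * c = 1 ->
  muV R n_gt0 (Delta v) = v * (x ^+ n.-1 * y ^+ 2).
Proof.
move=> nc.
rewrite Delta_xtens linearZ /= linearB !linearD /= !muV_xtens !mulr1.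
rewrite -[v * y * y]mulrA -expr2 -[v * x * _]mulrA -exprS prednK // xVn mulr0.
rewrite scaler0 oppr0 scaler0 addr0 -2!scalerDr -!scalerDl -!natrD scalerA.
rewrite -mulrA [y ^+ 2 * _]mulrC (_ : c * _ = 1) ?scale1r //.
by rewrite mulrC -[RHS]nc !mulSn mul0n addn0 addnA.
Qed.

Definition mV_elt : A :=
  if odd n then x ^+ n.-1./2 * y else x ^+ n.-2./2 * y ^+ 2.

Lemma mV_mul v : mV R n_gt0 v = v * mV_elt.
Proof. by rewrite mVE /mV_fun /mV_elt; case: ifP; rewrite mulrA. Qed.

(** For odd n, doubling the exponents suffices; for even n, y^4 = x y^2 supplies the missing factor
    x. *)
Lemma mV_elt_sqr : mV_elt ^+ 2 = x ^+ n.-1 * y ^+ 2.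
Proof.
rewrite /mV_elt; case: ifPn => n_odd; rewrite exprMn -exprM muln2.
  by rewrite even_halfK // -oddS prednK.
(* An even positive n is at least 2, so [n.-2] is the true n - 2. *)
have n_gt1 : (1 < n)%N.
  by rewrite ltn_neqAle n_gt0 andbT; apply: contraNneq n_odd => <-.
have -> : y ^+ 2 ^+ 2 = x * y ^+ 2.
  by rewrite -exprM -[(2 * 2)%N]/4%N exprSr yV3 -mulrA -expr2.
rewrite mulrA -exprSr even_halfK; last by rewrite -subn2 oddB // addbF.
by rewrite prednK // -subn1 subn_gt0.
Qed.

Definition counitl : 'Hom(tens VV VV, VV) := (tlun VV \o tensm eps \1)%VF.
Definition counitr : 'Hom(tens VV VV, VV) := (trun VV \o tensm \1 eps)%VF.

(** Only i = n - 1 survives, where the power of x in the second factor is 1. *)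
Lemma counitl_xtens p q j : p = y ^+ j -> (j < 3)%N ->
  counitl (xtens p q) = ((j == 2) * (3 * n))%:R *: q.
Proof.
move=> -> lt_j3; rewrite /xtens linear_sum /=.
have ltn' : (n.-1 < n)%N by rewrite ltn_predL.
rewrite (bigD1 (Ordinal ltn')) //= big1 => [|i neq_i].
  by rewrite !tensE mulrC eps_mon // eqxx subnn mul1r addr0 -natrM.
rewrite /counitl !tensE mulrC eps_mon //.
by rewrite -(inj_eq val_inj) /= in neq_i; rewrite (negPf neq_i) mul0r scale0r.
Qed.

(** Only i = 0 survives, where the second factor carries x^(n-1). *)
Lemma counitr_xtens p q j : q = y ^+ j -> (j < 3)%N ->
  counitr (xtens p q) = ((j == 2) * (3 * n))%:R *: p.
Proof.
move=> -> lt_j3; rewrite /xtens linear_sum /= (bigD1 (Ordinal n_gt0)) //= big1.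
  by rewrite !tensE subn0 eps_mon ?ltn_predL // eqxx mulr1 addr0 -natrM.
move=> i neq_i; rewrite /counitr !tensE eps_mon //; last first.
  by rewrite (leq_ltn_trans (leq_subr _ _)) ?ltn_predL.
rewrite -(inj_eq val_inj) /= in neq_i.
rewrite (_ : (_ == n.-1) = false) ?mul0r ?scale0r //.
have le_in : (i <= n.-1)%N by rewrite -ltnS prednK.
rewrite -[X in _ == X](subnK le_in) -[X in X == _]addn0 eqn_add2l.
by rewrite eq_sym (negPf neq_i).
Qed.

Lemma counitl_Delta1 : (3 * n)%:R * c = 1 -> counitl (Delta 1) = 1.
Proof.
move=> nc; rewrite Delta_xtens linearZ /= linearB !linearD /= !mul1r.
rewrite (counitl_xtens _ (j := 2)) // (counitl_xtens _ (j := 1)) ?expr1 //.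
(* The factor x is moved to the right so that the first slot is a power of y. *)
rewrite (counitl_xtens _ (j := 0)) ?expr0 // -[x]mul1r xtensx.
rewrite (counitl_xtens _ (j := 0)) ?expr0 // !mul0n mul1n.
rewrite !(scale0r, oppr0, scaler0, addr0).
by rewrite scalerA mulrC nc scale1r.
Qed.

Lemma counitr_Delta1 : (3 * n)%:R * c = 1 -> counitr (Delta 1) = 1.
Proof.
move=> nc; rewrite Delta_xtens linearZ /= linearB !linearD /= !mul1r.
rewrite (counitr_xtens _ (j := 0)) // (counitr_xtens _ (j := 1)) //.
rewrite (counitr_xtens _ (j := 2)) // (counitr_xtens _ (j := 0)) // !mul0n mul1n.
rewrite !(scale0r, oppr0, scaler0, addr0, add0r).
by rewrite scalerA mulrC nc scale1r.
Qed.

Lemma isMobiusFrobenius_V : (3 * n)%:R * c = 1 ->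
  @isMobiusFrobenius (RMod R) VV (muV R n_gt0) (etaV R n_gt0) Delta
    (epsV R n_gt0) (mV R n_gt0).
Proof.
move=> nc; have [a [b [DE Dbal]]] := Delta_sum.
split; [split; [split|]|..] => /=.
- apply: tens_ext3l => u v w.
  by rewrite !tensE !muVE -mulrA.
- apply: tens_ext => r v.
  by rewrite !tensE muVE etaVE.
- apply: tens_ext => v r.
  by rewrite !tensE muVE etaVE mulrC.
(* Coassociativity: both sides equal the sum of v a_k ⊗ a_l b_k ⊗ b_l. *)
- apply/lfunP => v; rewrite !comp_lfunE DE !linear_sum.
  transitivity (\sum_l \sum_k tasc VV VV VV
    (pureR (tens VV VV) (b l) (pure (v * a l * a k : VV) (b k : VV)))).
    by apply: eq_bigr => l _ /=; rewrite tensmE DE id_lfunE -pureRE !linear_sum.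
  transitivity (\sum_l \sum_k tasc VV VV VV
    (pureR (tens VV VV) (b l) (pure (v * a k : VV) (a l * b k : VV)))).
    by apply: eq_bigr => l _; rewrite -!linear_sum -Dbal.
  rewrite exchange_big; apply: eq_bigr => k _ /=.
  rewrite tensmE DE id_lfunE -pureLE linear_sum; apply: eq_bigr => l _ /=.
  by rewrite pureRE tascE pureLE [a l * _]mulrC.
- apply/lfunP => v; rewrite id_lfunE comp_lfunE.
  rewrite -[RHS]mulr1 -[1 in RHS](counitl_Delta1 nc).
  (* [Dbal] moves v to the second factor, where [eps] does not act. *)
  rewrite -[v in LHS]mul1r !DE Dbal !linear_sum mulr_sumr.
  by apply: eq_bigr => k _ /=; rewrite /counitl !tensE scalerAr.
- apply/lfunP => v; rewrite id_lfunE comp_lfunE.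
  rewrite -[RHS]mulr1 -[1 in RHS](counitr_Delta1 nc).
  rewrite !DE !linear_sum mulr_sumr.
  by apply: eq_bigr => k _ /=; rewrite /counitr !tensE mul1r scalerAr.
- apply: tens_ext => u v; rewrite !tensE muVE !DE -pureLE !linear_sum.
  by apply: eq_bigr => k _ /=; rewrite pureLE !tensE muVE mulrA.
- apply: tens_ext => u v; rewrite !tensE muVE !DE Dbal -pureRE !linear_sum.
  by apply: eq_bigr => k _ /=; rewrite pureRE !tensE muVE [v * _]mulrC.
- by apply: tens_ext => u v; rewrite !tensE !muVE mulrC.
- by apply: tens_ext => u v; rewrite !tensE !muVE !mV_mul mulrAC.
- by apply: tens_ext => u v; rewrite !tensE !muVE !mV_mul mulrA.
- apply/lfunP => v; rewrite !comp_lfunE muV_Delta // !mV_mul.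
  by rewrite -mV_elt_sqr mulrA.
Qed.

End Frobenius.

Theorem lemma5p1p3 (n : nat) (n_gt0 : (0 < n)%N) :
  let R : comNzRingType := Zinv (3 * n) in
  @isMobiusFrobenius (RMod R) (V R n_gt0)
    (muV R n_gt0) (etaV R n_gt0) (DeltaV n_gt0 (invN (3 * n)))
    (epsV R n_gt0) (mV R n_gt0).
Proof. by apply: isMobiusFrobenius_V; rewrite invNK // muln_gt0. Qed.
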